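(* Let $G$ be a connected non-complete graph with $n$ vertices, let $N=\binom{n}{2}$, and let $\alpha$ be a real number with $\mathrm{Sz}^{\alpha}(G)=W^{\alpha}(G)$. Let $n_1\ge n_2\ge\dots\ge n_N$ be the values $n_u(v)\cdot n_v(u)$ over the edges $uv$ of $G$, ordered decreasingly and extended by zero terms to length $N$, and let $d_1\ge\dots\ge d_N$ be the distances $d(u,v)$ over unordered pairs of distinct vertices, ordered decreasingly. If the sequence $(n_i^{\alpha})_i$ majorizes the sequence $(d_i^{\alpha})_i$, then $\alpha$ is the unique real number $\beta$ satisfying $\mathrm{Sz}^{\beta}(G)=W^{\beta}(G)$.
   Context: For an edge $uv$ of a connected graph $G$, $n_u(v)$ is the number of vertices strictly closer to $u$ than to $v$ (including $u$), and $n_v(u)$ symmetrically. $W^{\alpha}(G)=\sum_{\{u,v\}}d(u,v)^{\alpha}$ (over unordered pairs of distinct vertices) and $\mathrm{Sz}^{\alpha}(G)=\sum_{uv\in E(G)}(n_u(v)n_v(u))^{\alpha}$. A decreasing sequence $(x_i)$ majorizes a decreasing sequence $(y_i)$ if $\sum_{i\le k}x_i\ge\sum_{i\le k}y_i$ for every positive integer $k$ (missing terms taken to be $0$); the zero terms of $(n_i)$ contribute $0^{\alpha}=0$. *)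

(* Defs.v *)
From HB Require Import structures.
From mathcomp Require Import all_boot all_order all_algebra.
From mathcomp Require Import all_classical all_reals all_analysis.

Set Implicit Arguments.
Unset Strict Implicit.
Unset Printing Implicit Defensive.

Import Order.TTheory GRing.Theory Num.Theory.

Local Open Scope ring_scope.

(* A finite simple graph is a symmetric irreflexive relation e on a finType T. *)
Section Graph.
Variables (T : finType) (e : rel T).

Definition walkb (u v : T) (k : nat) : bool :=
  [exists p : k.-tuple T, path e u p && (last u p == v)].

(* The least length of a walk from u to v; lengths below #|T| suffice because
   a shortest walk repeats no vertex. The value is #|T| when there is no walk. *)
Definition gdist (u v : T) : nat := find (walkb u v) (iota 0 #|T|).

Lemma gdist_min (u : T) (p : seq T) :
  path e u p -> (gdist u (last u p) <= size p)%N.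
Proof.
move=> up; rewrite leqNgt; apply/negP => lt_p.
have szT : (gdist u (last u p) <= #|T|)%N.
  by rewrite -[leqRHS](size_iota 0) find_size.
have := before_find 0%N lt_p; rewrite nth_iota ?add0n; last first.
  exact: leq_trans lt_p szT.
by move/negbT/negP; apply; apply/existsP; exists (in_tuple p); rewrite up eqxx.
Qed.

Lemma gdist_attained (u v : T) : connect e u v ->
  exists p : seq T, [/\ path e u p, last u p = v & size p = gdist u v].
Proof.
case/connectP => q uq ->; case/shortenP: uq => p up Up _.
have szp : (size p < #|T|)%N.
  by have := max_card (mem (u :: p)); rewrite (card_uniqP Up).
have hasw : has (walkb u (last u p)) (iota 0 #|T|).
  apply/hasP; exists (size p); first by rewrite mem_iota add0n.
  by apply/existsP; exists (in_tuple p); rewrite up eqxx.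
have := nth_find 0%N hasw; rewrite nth_iota ?add0n; last first.
  by move: hasw; rewrite has_find size_iota.
case/existsP => r /andP[ur /eqP lr].
by exists r; split => //; rewrite size_tuple.
Qed.

(* n_u(v) *)
Definition ncloser (u v : T) : nat := #|[set w | (gdist w u < gdist w v)%N]|.

(* Each unordered pair of distinct vertices is listed once, as the pair (u, v)
   whose first component comes first in the enumeration of T. *)
Definition upairs : seq (T * T) :=
  [seq p <- enum {: T * T} | (enum_rank p.1 < enum_rank p.2)%N].

Lemma mem_upairs (u v : T) :
  u != v -> ((u, v) \in upairs) = ((v, u) \notin upairs).
Proof.
have mem_upair x y : ((x, y) \in upairs) = (enum_rank x < enum_rank y)%N.
  by rewrite mem_filter /= -/(enum _) mem_enum andbT.
rewrite !mem_upair -leqNgt ltn_neqAle => uv.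
suff -> : (enum_rank u != enum_rank v :> nat) by [].
by rewrite (inj_eq val_inj) (inj_eq enum_rank_inj).
Qed.

Definition edges : seq (T * T) := [seq p <- upairs | e p.1 p.2].

Definition edge_val (p : T * T) : nat :=
  (ncloser p.1 p.2 * ncloser p.2 p.1)%N.

(* (n_i), of length 'C(#|T|, 2), and (d_i) *)
Definition edge_vals : seq nat :=
  sort geq ([seq edge_val p | p <- edges] ++
            nseq ('C(#|T|, 2) - size edges)%N 0%N).

Definition dists : seq nat := sort geq [seq gdist p.1 p.2 | p <- upairs].

End Graph.

Section Indices.
Variable R : realType.

(* powR has 0 `^ 0 = 1, whereas 0 ^ a = 0 for every a is wanted here. *)
Definition npow (m : nat) (a : R) : R := if m == 0%N then 0 else m%:R `^ a.

Definition wiener (T : finType) (e : rel T) (a : R) : R :=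
  \sum_(p <- upairs T) npow (gdist e p.1 p.2) a.

Definition szeged (T : finType) (e : rel T) (a : R) : R :=
  \sum_(p <- edges e) npow (edge_val e p) a.

(* nth 0 supplies the missing terms *)
Definition majorizes (x y : seq R) : Prop :=
  [/\ sorted >=%R x, sorted >=%R y &
      forall k : nat, (0 < k)%N -> \sum_(i < k) y`_i <= \sum_(i < k) x`_i].

End Indices.

(* Main.v *)
Require Import Defs.
From HB Require Import structures.
From mathcomp Require Import all_boot all_order all_algebra.
From mathcomp Require Import all_classical all_reals all_analysis.
From mathcomp Require Import ring lra.

Set Implicit Arguments.
Unset Strict Implicit.
Unset Printing Implicit Defensive.

Import Order.TTheory GRing.Theory Num.Theory.

Local Open Scope ring_scope.

(* For exponents [b <= 0] every edge contributes at most 1 to the Szeged sum and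
   exactly 1 to the Wiener sum, and the non-adjacent pairs give the Wiener sum
   an extra positive contribution; hence Sz^b < W^b, and in particular
   [alpha > 0]. For [b > 0], [b != alpha], the sums at [b] are obtained from the
   ones at [alpha] by applying [x |-> x ^ (b / alpha)], which is strictly convex
   or strictly concave, so Karamata's inequality separates them: it is strict
   because some [n_i] is 0 while every [d_i] is positive. *)

(** * Strict Karamata inequality by Abel summation *)

Section Karamata.
Variable R : realType.

(** Abel summation, by induction: lowering the coefficient of a nonnegative partial sum from [c n]
    to [c n.+1] can only decrease the product. *)
Lemma abel_sum_ge (c D : nat -> R) (n : nat) :
  (forall i, (i < n)%N -> c i.+1 <= c i) ->
  (forall k, (k <= n)%N -> 0 <= \sum_(i < k) D i) ->
  c n * \sum_(i < n.+1) D i <= \sum_(i < n.+1) c i * D i.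
Proof.
elim: n => [|n IHn] c_noninc sumD_ge0; first by rewrite !big_ord1.
rewrite [in leRHS]big_ord_recr [in leLHS]big_ord_recr /= mulrDr lerD2r.
apply: le_trans (IHn _ _) => [||k kn]; last by apply: sumD_ge0; rewrite leqW.
  by apply: ler_wpM2r; [exact: sumD_ge0 | exact: c_noninc].
by move=> i ilt; apply: c_noninc; rewrite leqW.
Qed.

(* [c] plays the role of a subderivative of a convex function [f] on
   [[0, +oo[]: Karamata follows by Abel summation from the tangent lines at the
   [y i]. *)
Lemma karamata_lt (f c : R -> R) (x y : nat -> R) (n j : nat) :
  (forall a b, 0 < a -> a <= b -> c a <= c b) ->
  (forall a b, 0 <= a -> 0 < b -> f b + c b * (a - b) <= f a) ->
  (forall b, 0 < b -> f b - c b * b < f 0) ->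
  (forall i, (i < n)%N -> 0 <= x i) ->
  (forall i, (i < n)%N -> 0 < y i) ->
  (forall i, (i.+1 < n)%N -> y i.+1 <= y i) ->
  (forall k, \sum_(i < k) y i <= \sum_(i < k) x i) ->
  \sum_(i < n) x i = \sum_(i < n) y i ->
  (j < n)%N -> x j = 0 ->
  \sum_(i < n) f (y i) < \sum_(i < n) f (x i).
Proof.
move=> c_mono tangent tangent0 x_ge0 y_gt0 y_noninc maj eq_sum jn xj0.
(* The partial sums of [x i - y i] are nonnegative by majorization and the total is 0, so the lower
   bound given by Abel summation is 0. *)
have slope : 0 <= \sum_(i < n) c (y i) * (x i - y i).
  case: n jn y_noninc y_gt0 eq_sum {x_ge0} => // n _ y_noninc y_gt0 eq_sum.
  have := @abel_sum_ge (fun i => c (y i)) (fun i => x i - y i) n.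
  rewrite sumrB eq_sum subrr mulr0; apply=> [i ilt|k _]; last first.
    by rewrite sumrB subr_ge0.
  by apply: c_mono; [apply: y_gt0 | apply: y_noninc].
apply: le_lt_trans (_ : \sum_(i < n) (f (y i) + c (y i) * (x i - y i)) < _).
  by rewrite big_split /= lerDl.
(* Index [j] is isolated: since [x j = 0], the tangent inequality is strict there. *)
rewrite (bigD1 (Ordinal jn)) //= [ltRHS](bigD1 (Ordinal jn)) //=.
apply: ltr_leD.
  by rewrite xj0 sub0r mulrN; apply/tangent0/y_gt0.
by apply: ler_sum => i _; apply: tangent; [apply: x_ge0 | apply: y_gt0].
Qed.

(** * Tangent lines and slopes of power functions *)

Lemma powRB1 (y p : R) : 0 < y -> y `^ (p - 1) * y = y `^ p.
Proof.
move=> y0; rewrite -[X in _ * X]powRr1 ?ltW// -powRD ?subrK//.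
by rewrite (gt_eqF y0) implybT.
Qed.

(** Young's inequality for [x] and [y ^ (p - 1)] with conjugate exponents [p] and [p / (p - 1)],
    multiplied by [p]. *)
Lemma powR_tangent_le (p x y : R) : 1 < p -> 0 <= x -> 0 < y ->
  y `^ p + p * y `^ (p - 1) * (x - y) <= x `^ p.
Proof.
move=> p1 x0 y0.
have p0 : 0 < p by lra.
have pn0 : p != 0 by rewrite gt_eqF.
have p1n0 : p - 1 != 0 by rewrite subr_eq0 gt_eqF.
have q0 : 0 < p / (p - 1) by rewrite divr_gt0 ?subr_gt0.
have := @conjugate_powR R x (y `^ (p - 1)) p (p / (p - 1)) x0
  (powR_ge0 _ _) p0 q0.
have -> : p^-1 + (p / (p - 1))^-1 = 1 by field; apply/andP.
move=> /(_ erefl).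
rewrite -powRrM mulrCA divff // mulr1 => H.
have := ler_wpM2l (ltW p0) H.
have -> : p * (x `^ p / p + y `^ p / (p / (p - 1))) = x `^ p + (p - 1) * y `^ p.
  by field; apply/andP.
have := powRB1 p y0; set u := y `^ (p - 1) => uE; rewrite -uE => H2.
by nra.
Qed.

(** Young's inequality for [x ^ p] and [y ^ (1 - p)] with exponents [1 / p] and [1 / (1 - p)] is
    weighted AM-GM; multiplying by [y ^ (p - 1)] gives the tangent line. *)
Lemma powR_tangent_ge (p x y : R) : 0 < p < 1 -> 0 <= x -> 0 < y ->
  x `^ p <= y `^ p + p * y `^ (p - 1) * (x - y).
Proof.
move=> /andP[p0 p1] x0 y0.
have pn0 : p != 0 by rewrite gt_eqF.
have p1n0 : 1 - p != 0 by rewrite subr_eq0 gt_eqF.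
have := @conjugate_powR R (x `^ p) (y `^ (1 - p)) p^-1 (1 - p)^-1
  (powR_ge0 _ _) (powR_ge0 _ _).
rewrite !invr_gt0 subr_gt0 !invrK => /(_ p0 p1).
rewrite addrC subrK => /(_ erefl).
rewrite -!powRrM !divff // !powRr1 ?(ltW y0)// => H.
have v_gt0 : 0 < y `^ (p - 1) by apply: powR_gt0.
have := ler_wpM2r (ltW v_gt0) H.
have -> : x `^ p * y `^ (1 - p) * y `^ (p - 1) = x `^ p.
  by rewrite -[p - 1]opprB powRN mulfK // gt_eqF // powR_gt0.
have := powRB1 p y0; set u := y `^ (p - 1) => uE; rewrite -uE => H2.
by nra.
Qed.

Lemma powR_slope_le (p a b : R) : 1 < p -> 0 < a -> a <= b ->
  p * a `^ (p - 1) <= p * b `^ (p - 1).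
Proof.
move=> p1 a0 ab; apply: ler_wpM2l; first lra.
by apply: ge0_ler_powR => //; rewrite ?nnegrE; lra.
Qed.

Lemma powR_slope_ge (p a b : R) : 0 < p < 1 -> 0 < a -> a <= b ->
  p * b `^ (p - 1) <= p * a `^ (p - 1).
Proof.
move=> /andP[p0 p1] a0 ab; apply: ler_wpM2l; first lra.
have b0 : 0 < b by lra.
rewrite -[p - 1]opprB !powRN lef_pV2 ?posrE ?powR_gt0//.
by apply: ge0_ler_powR => //; rewrite ?nnegrE; lra.
Qed.

(** * Strict Karamata for convex and concave powers *)

Section Powers.
Variables (x y : nat -> R) (n j : nat).
Hypothesis x_ge0 : forall i, (i < n)%N -> 0 <= x i.
Hypothesis y_gt0 : forall i, (i < n)%N -> 0 < y i.
Hypothesis y_noninc : forall i, (i.+1 < n)%N -> y i.+1 <= y i.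
Hypothesis maj : forall k, \sum_(i < k) y i <= \sum_(i < k) x i.
Hypothesis eq_sum : \sum_(i < n) x i = \sum_(i < n) y i.
Hypotheses (jn : (j < n)%N) (xj0 : x j = 0).

Lemma karamata_powR_gt1 (p : R) : 1 < p ->
  \sum_(i < n) y i `^ p < \sum_(i < n) x i `^ p.
Proof.
move=> p1; apply: (@karamata_lt (fun t => t `^ p)
  (fun t => p * t `^ (p - 1)) x y n j) => //.
- by move=> a b; apply: powR_slope_le.
- by move=> a b; apply: powR_tangent_le.
(* At 0 the tangent line at [b] has the value [(1 - p) * b ^ p], which is negative. *)
move=> b b0; rewrite -mulrA powRB1// powR0 ?gt_eqF//; last lra.
by have := powR_gt0 p b0; nra.
Qed.

Lemma karamata_powR_lt1 (p : R) : 0 < p < 1 ->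
  \sum_(i < n) x i `^ p < \sum_(i < n) y i `^ p.
Proof.
(* Negation turns the concave power into a convex function. *)
move=> p01; rewrite -ltrN2 -!sumrN.
apply: (@karamata_lt (fun t => - t `^ p)
  (fun t => - (p * t `^ (p - 1))) x y n j) => //.
- by move=> a b a0 ab; rewrite lerN2 powR_slope_ge.
- by move=> a b a0 b0; rewrite mulNr -opprD lerN2 powR_tangent_ge.
case/andP: p01 => p0 p1 b b0.
rewrite mulNr opprK -mulrA powRB1// powR0 ?gt_eqF//.
by have := powR_gt0 p b0; nra.
Qed.

End Powers.
End Karamata.

(** * Powers and sorting of integer sequences padded by zeros *)

Section Sequences.
Variable R : realType.

Lemma npow_ge0 (m : nat) (a : R) : 0 <= npow m a.
Proof. by rewrite /npow; case: eqP => // _; apply: powR_ge0. Qed.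

Lemma npow_gt0 (m : nat) (a : R) : (0 < m)%N -> 0 < npow m a.
Proof. by case: m => // m _; apply: powR_gt0; rewrite ltr0n. Qed.

Lemma npow1 (a : R) : npow 1 a = 1.
Proof. by rewrite /npow /= powR1. Qed.

Lemma npow_le1 (m : nat) (a : R) : (0 < m)%N -> a <= 0 -> npow m a <= 1.
Proof.
case: m => // m _ a0; rewrite /npow /= -[leRHS](powRr0 (m.+1%:R : R)).
by apply: ler_powR; rewrite // ler1n.
Qed.

(** At [m = 0] this reads [0 = 0 ^ p], which fails for [p = 0]. *)
Lemma npowM (m : nat) (a p : R) : p != 0 -> npow m (a * p) = npow m a `^ p.
Proof.
by move=> p0; rewrite /npow; case: eqP => _; rewrite ?powR0 ?powRrM.
Qed.

Lemma nth_npow (s : seq nat) (a : R) (i : nat) :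
  [seq npow m a | m <- s]`_i = npow (nth 0%N s i) a.
Proof.
case: (ltnP i (size s)) => si; first by rewrite (nth_map 0%N).
by rewrite !nth_default ?size_map.
Qed.

(** Past the end of [s], [nth] returns 0 and [npow 0 a = 0] for every [a], so the extra indices add
    nothing. *)
Lemma sum_npow_nth (s : seq nat) (a : R) (n : nat) : (size s <= n)%N ->
  \sum_(i < n) npow (nth 0%N s i) a = \sum_(m <- s) npow m a.
Proof.
move=> sn; rewrite (big_nth 0%N) big_mkord.
rewrite [RHS](big_ord_widen n (fun i => npow (nth 0%N s i) a)) //.
rewrite [RHS]big_mkcond; apply: eq_bigr => i _.
by case: ltnP => // ?; rewrite nth_default.
Qed.

End Sequences.

Lemma geq_trans : transitive geq.
Proof. by move=> m n p nm mp; apply: leq_trans mp nm. Qed.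

Lemma geq_anti : antisymmetric geq.
Proof. by move=> m n mn; apply/anti_leq; rewrite andbC. Qed.

Lemma geq_total : total geq.
Proof. by move=> m n; rewrite /geq /= leq_total. Qed.

Lemma sort_geq_cat_nseq0 (s : seq nat) (k : nat) :
  sort geq (s ++ nseq k 0%N) = sort geq s ++ nseq k 0%N.
Proof.
apply: (sorted_eq geq_trans geq_anti).
- exact: sort_sorted geq_total _.
- rewrite (sorted_pairwise geq_trans) pairwise_cat.
  rewrite -!(sorted_pairwise geq_trans) (sort_sorted geq_total) /=.
  apply/andP; split.
    by apply/allrelP => m z _ /nseqP[-> _].
  by rewrite (sorted_pairwise geq_trans); elim: k => //= k ->;
    rewrite all_nseq orbT.
by rewrite perm_sort perm_cat2r perm_sym perm_sort.
Qed.

(** * Distances, edge values and the two indices of the graph *)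

Section Graph.
Variables (R : realType) (T : finType) (e : rel T).
Hypothesis e_sym : symmetric e.
Hypothesis e_irr : irreflexive e.
Hypothesis e_connected : forall u v : T, connect e u v.
Hypothesis e_noncomplete : ~ (forall u v : T, u != v -> e u v).

Lemma gdistxx (u : T) : gdist e u u = 0%N.
Proof. by apply/eqP; rewrite -leqn0; apply: (@gdist_min _ e u [::]). Qed.

Lemma gdist_gt0 (u v : T) : u != v -> (0 < gdist e u v)%N.
Proof.
have [p [_ + <-]] := gdist_attained (e_connected u v).
by case: p => //= ->; rewrite eqxx.
Qed.

Lemma edge_neq (u v : T) : e u v -> u != v.
Proof. by apply: contraTneq => ->; rewrite e_irr. Qed.

Lemma gdist_edge (u v : T) : e u v -> gdist e u v = 1%N.
Proof.
move=> uv; apply/eqP; rewrite eqn_leq gdist_gt0 ?edge_neq// andbT.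
by apply: (@gdist_min _ e u [:: v]); rewrite /= uv.
Qed.

Lemma ncloser_gt0 (u v : T) : u != v -> (0 < ncloser e u v)%N.
Proof.
by move=> uv; apply/card_gt0P; exists u; rewrite inE gdistxx gdist_gt0.
Qed.

Lemma edge_val_gt0 (p : T * T) : e p.1 p.2 -> (0 < edge_val e p)%N.
Proof.
by move=> /edge_neq uv; rewrite muln_gt0 !ncloser_gt0// eq_sym.
Qed.

Lemma upairs_neq (p : T * T) : p \in upairs T -> p.1 != p.2.
Proof.
by rewrite mem_filter => /andP[+ _]; apply: contraTneq => ->; rewrite ltnn.
Qed.

Lemma upairs_nonedge : exists2 p, p \in upairs T & ~~ e p.1 p.2.
Proof.
apply: contra_notP e_noncomplete => noP u v uv.
apply/negP => /negP Neuv; apply: noP.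
(* Only one orientation of the pair is listed; symmetry of [e] carries the non-adjacency over to
   it. *)
have := mem_upairs uv; case: (boolP ((v, u) \in upairs T)) => [vu _|_ uv'].
  by exists (v, u); rewrite //= e_sym.
by exists (u, v).
Qed.

(** This provides the zero term among the [n_i] that makes Karamata strict. *)
Lemma size_edges_lt : (size (edges e) < size (upairs T))%N.
Proof.
rewrite size_filter ltn_neqAle count_size andbT -all_count.
have [p pT Np] := upairs_nonedge.
by apply/negP => /allP/(_ p pT); apply/negP.
Qed.

Lemma szeged_lt_wiener (b : R) : b <= 0 -> szeged e b < wiener e b.
Proof.
move=> b0; rewrite /szeged /wiener big_filter big_mkcond -subr_gt0 -sumrB.
have [p pT Np] := upairs_nonedge.
(* The non-adjacent pair contributes its whole positive Wiener term; all other differences are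
   nonnegative. *)
rewrite (big_rem p) //= (negbTE Np) subr0 ltr_wpDr //; last first.
  by rewrite npow_gt0 // gdist_gt0 // upairs_neq.
apply: sumr_ge0 => q _; case: ifP => eq; last by rewrite subr0 npow_ge0.
by rewrite gdist_edge // npow1 subr_ge0 npow_le1 // edge_val_gt0.
Qed.

Let vals := sort geq [seq edge_val e p | p <- edges e].

Lemma size_vals : size vals = size (edges e).
Proof. by rewrite size_sort size_map. Qed.

(** The padding zeros are sorted to the end, where they agree with the default value of [nth]. *)
Lemma nth_edge_vals (i : nat) : nth 0%N (edge_vals e) i = nth 0%N vals i.
Proof.
rewrite /edge_vals sort_geq_cat_nseq0 nth_cat -/vals; case: ltnP => // si.
by rewrite nth_nseq if_same nth_default.
Qed.

Lemma size_dists : size (dists e) = size (upairs T).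
Proof. by rewrite size_sort size_map. Qed.

(** Indexing by all pairs instead of edges gives both sums the same range, as Karamata requires. *)
Lemma szeged_nth (b : R) :
  szeged e b = \sum_(i < size (upairs T)) npow (nth 0%N vals i) b.
Proof.
rewrite sum_npow_nth ?size_vals ?(ltnW size_edges_lt)//.
by rewrite (perm_big _ (permEl (perm_sort _ _))) big_map.
Qed.

Lemma wiener_nth (b : R) :
  wiener e b = \sum_(i < size (upairs T)) npow (nth 0%N (dists e) i) b.
Proof.
rewrite sum_npow_nth ?size_dists//.
by rewrite (perm_big _ (permEl (perm_sort _ _))) big_map.
Qed.

Lemma nth_dists_gt0 (i : nat) :
  (i < size (upairs T))%N -> (0 < nth 0%N (dists e) i)%N.
Proof.
rewrite -size_dists => /(mem_nth 0%N); rewrite mem_sort.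
by case/mapP => p pT ->; rewrite gdist_gt0 ?upairs_neq.
Qed.

(** * Comparison at positive exponents other than [alpha] *)

Section Majorization.
Variable alpha : R.
Hypothesis eq_alpha : szeged e alpha = wiener e alpha.
Hypothesis maj : majorizes [seq npow m alpha | m <- edge_vals e]
                           [seq npow m alpha | m <- dists e].

Lemma szeged_eq_exponent_gt0 : 0 < alpha.
Proof.
by rewrite ltNge; apply/negP => /szeged_lt_wiener; rewrite eq_alpha ltxx.
Qed.

Let x i := npow (nth 0%N vals i) alpha.
Let y i := npow (nth 0%N (dists e) i) alpha.

Lemma majorizes_sum_le (k : nat) : \sum_(i < k) y i <= \sum_(i < k) x i.
Proof.
case: k => [|k]; first by rewrite !big_ord0.
case: maj => _ _ /(_ k.+1 isT).
under eq_bigr do rewrite nth_npow.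
by under [leRHS]eq_bigr do rewrite nth_npow nth_edge_vals.
Qed.

Lemma npow_dists_noninc (i : nat) :
  (i.+1 < size (upairs T))%N -> y i.+1 <= y i.
Proof.
move=> ilt; case: maj => _ /(sortedP 0)/(_ i) + _.
by rewrite size_map size_dists !nth_npow; apply.
Qed.

Lemma szeged_neq_wiener (b : R) : 0 < b -> b != alpha ->
  szeged e b <> wiener e b.
Proof.
move=> b0 ba; have a0 := szeged_eq_exponent_gt0.
have p0 : 0 < b / alpha by rewrite divr_gt0.
have bE : b = alpha * (b / alpha) by rewrite mulrC divfK // gt_eqF.
have x_ge0 i : (i < size (upairs T))%N -> 0 <= x i by move=> _; apply: npow_ge0.
have y_gt0 i : (i < size (upairs T))%N -> 0 < y i.
  by move=> ilt; apply/npow_gt0/nth_dists_gt0.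
have eq_sum : \sum_(i < size (upairs T)) x i = \sum_(i < size (upairs T)) y i.
  by rewrite -szeged_nth -wiener_nth.
(* [vals] has one entry per edge, so this index lies just past its end. *)
have x0 : x (size (edges e)) = 0 by rewrite /x nth_default ?size_vals.
rewrite szeged_nth wiener_nth bE.
under eq_bigr do rewrite npowM ?gt_eqF//.
under [in RHS]eq_bigr do rewrite npowM ?gt_eqF//.
(* The power is strictly concave below 1 and strictly convex above 1; ratio 1 would mean
   [b = alpha]. *)
have [p1|p1|p1] := ltgtP (b / alpha) 1.
- apply/eqP; rewrite lt_eqF //.
  by apply: (karamata_powR_lt1 x_ge0 y_gt0 npow_dists_noninc majorizes_sum_le
    eq_sum size_edges_lt x0); rewrite p0.
- apply/eqP; rewrite gt_eqF //.
  exact: (karamata_powR_gt1 x_ge0 y_gt0 npow_dists_noninc majorizes_sum_le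
    eq_sum size_edges_lt x0).
- by case/eqP: ba; rewrite [LHS]bE p1 mulr1.
Qed.

End Majorization.
End Graph.

Theorem theorem8 (R : realType) (T : finType) (e : rel T)
    (e_sym : symmetric e) (e_irr : irreflexive e)
    (e_connected : forall u v : T, connect e u v)
    (e_noncomplete : ~ (forall u v : T, u != v -> e u v))
    (alpha : R) (eq_alpha : szeged e alpha = wiener e alpha)
    (maj : majorizes [seq npow m alpha | m <- edge_vals e]
                     [seq npow m alpha | m <- dists e]) :
  forall beta : R, szeged e beta = wiener e beta <-> beta = alpha.
Proof.
move=> beta; split=> [eq_beta|->//].
(* Positivity follows from equality of the indices alone, so it applies to [beta] as well as to
   [alpha]. *)
have beta_gt0 :=
  szeged_eq_exponent_gt0 e_sym e_irr e_connected e_noncomplete eq_beta.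
apply/eqP/negPn/negP => neq.
exact: (szeged_neq_wiener e_sym e_irr e_connected e_noncomplete eq_alpha maj
  beta_gt0 neq eq_beta).
Qed.
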